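(* Let $G_1$ and $G_2$ be graphs and $G=G_1+G_2$. Then the clique graph $K(G)$ is complete if and only if $K(G_1)$ is complete or $K(G_2)$ is complete.
   Context: Graphs are simple. A clique of a graph is a maximal complete subgraph. For a graph $H$, the clique graph $K(H)$ has as vertex set the set of all cliques of $H$, two distinct cliques being adjacent iff they share at least one vertex. The join $G_1+G_2$ is obtained from the disjoint union of $G_1$ and $G_2$ by adding all edges between a vertex of $G_1$ and a vertex of $G_2$. *)

(* Defs.v *)
From mathcomp Require Import all_boot.
From mathcomp Require Import boolp classical_sets.

Set Implicit Arguments.
Unset Strict Implicit.
Unset Printing Implicit Defensive.

Local Open Scope classical_set_scope.

(* Simple graphs, finite or infinite, with the usual convention that a graph
   has at least one vertex. *)
Record graph := Graph {
  vertex :> Type;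
  adj : vertex -> vertex -> Prop;
  adj_sym : forall x y, adj x y -> adj y x;
  adj_irrefl : forall x, ~ adj x x;
  vertex_inhabited : inhabited vertex }.

Definition complete_graph (G : graph) : Prop :=
  forall x y : G, x <> y -> adj x y.

(* A complete subgraph has all the edges between its vertices, so it is
   represented by its vertex set. *)
Definition complete_set (G : graph) (Q : set G) : Prop :=
  forall x y, Q x -> Q y -> x <> y -> adj x y.

Definition clique (G : graph) (Q : set G) : Prop :=
  complete_set Q /\ forall Q' : set G, complete_set Q' -> Q `<=` Q' -> Q' = Q.

Lemma clique_exists (G : graph) : inhabited {Q : set G | clique Q}.
Proof.
have [F FP Ftot|Q [Qc Qmax]] := @Zorn_bigcup G (@complete_set G).
  move=> x y [A FA Ax] [B FB By].
  have [AB|BA] := Ftot _ _ FA FB.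
    by apply: (FP _ FB) => //; exact: AB.
  by apply: (FP _ FA) => //; exact: BA.
apply: inhabits; exists Q; split=> // Q' Q'c QQ'.
apply/seteqP; split=> //; apply: contrapT => nQ'Q.
by apply: (Qmax Q') => //; split.
Qed.

Section CliqueGraph.
Variable G : graph.

Definition clique_adj (P Q : {Q : set G | clique Q}) : Prop :=
  P <> Q /\ (sval P `&` sval Q) !=set0.

Lemma clique_adj_sym P Q : clique_adj P Q -> clique_adj Q P.
Proof. by case=> PQ PIQ; split; [move/esym | rewrite setIC]. Qed.

Lemma clique_adj_irrefl P : ~ clique_adj P P.
Proof. by case. Qed.

Definition clique_graph : graph :=
  Graph clique_adj_sym clique_adj_irrefl (clique_exists G).

End CliqueGraph.

Section GraphJoin.
Variables G1 G2 : graph.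

Definition join_adj (u v : G1 + G2) : Prop :=
  match u, v with
  | inl x, inl y => adj x y
  | inr x, inr y => adj x y
  | _, _ => True
  end.

Lemma join_adj_sym u v : join_adj u v -> join_adj v u.
Proof. by case: u v => [x|x] [y|y] //=; exact: adj_sym. Qed.

Lemma join_adj_irrefl u : ~ join_adj u u.
Proof. by case: u => x; exact: adj_irrefl. Qed.

Lemma join_inhabited : inhabited (G1 + G2).
Proof. by case: (vertex_inhabited G1) => x; exact: inhabits (inl x). Qed.

Definition graph_join : graph :=
  Graph join_adj_sym join_adj_irrefl join_inhabited.

End GraphJoin.

(* Main.v *)
Require Import Defs.
From mathcomp Require Import all_boot.
From mathcomp Require Import boolp classical_sets.

(** The cliques of the join are exactly the disjoint unions of a clique of [G1]
    and a clique of [G2], and two such unions meet iff they meet in one of the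
    two sides. So a pair of disjoint cliques of the join amounts to a pair of
    disjoint cliques of [G1] together with one of [G2]. *)

Set Implicit Arguments.
Unset Strict Implicit.
Unset Printing Implicit Defensive.

Local Open Scope classical_set_scope.

(** The empty set is complete but never maximal: a graph has a vertex, and any singleton is a larger
    complete set. *)
Lemma clique_nonempty (G : graph) (Q : set G) : clique Q -> Q !=set0.
Proof.
move=> [_ Qmax]; apply: contrapT => Q0.
have [x] := vertex_inhabited G.
have Qx : [set x] = Q.
  apply: Qmax; first by move=> u v -> ->.
  by move=> y Qy; case: Q0; exists y.
by apply: Q0; exists x; rewrite -Qx.
Qed.

(* Nonemptiness of cliques covers the case [P = Q], where [K(G)] has no edge. *)
Lemma complete_clique_graphP (G : graph) :
  complete_graph (clique_graph G) <->
  forall P Q : set G, clique P -> clique Q -> (P `&` Q) !=set0.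
Proof.
split=> [KG P Q cP cQ | meet [P cP] [Q cQ] PQ]; last by split=> //; exact: meet.
have [->|PQ] := pselect (P = Q); first by rewrite setIid; exact: clique_nonempty.
have neq : exist _ P cP <> exist _ Q cQ :> clique_graph G.
  by move=> /(congr1 sval).
by have [] := KG _ _ neq.
Qed.

Lemma not_complete_clique_graph (G : graph) :
  ~ complete_graph (clique_graph G) ->
  exists P Q : set G, [/\ clique P, clique Q & ~ ((P `&` Q) !=set0)].
Proof.
move=> nKG; apply: contrapT => nPQ; apply/nKG/complete_clique_graphP => P Q cP cQ.
by apply: contrapT => PQ0; apply: nPQ; exists P, Q.
Qed.

Section CliquesOfJoin.
Variables G1 G2 : graph.

Definition join_set (A1 : set G1) (A2 : set G2) : set (graph_join G1 G2) :=
  fun u => match u with inl x => A1 x | inr y => A2 y end.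

(** Allows an arbitrary vertex set of the join to be treated one side at a time. *)
Lemma join_setE (A : set (graph_join G1 G2)) :
  A = join_set (fun x => A (inl x)) (fun y => A (inr y)).
Proof. by apply/funext => -[]. Qed.

Lemma join_setI_nonempty A1 A2 B1 B2 :
  (join_set A1 A2 `&` join_set B1 B2) !=set0 <->
  (A1 `&` B1) !=set0 \/ (A2 `&` B2) !=set0.
Proof.
split=> [[[x|y] [Au Bu]] | [[x [Ax Bx]] | [y [Ay By]]]].
- by left; exists x.
- by right; exists y.
- by exists (inl x).
- by exists (inr y).
Qed.

Lemma complete_join_set A1 A2 :
  complete_set (join_set A1 A2) <-> complete_set A1 /\ complete_set A2.
Proof.
split=> [cA | [cA1 cA2]].
  split=> x y Ax Ay xy.
    by apply: (cA (inl x) (inl y)) => // -[].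
  by apply: (cA (inr x) (inr y)) => // -[].
(* The two mixed cases are trivial, as the join has all edges between the sides. *)
by move=> [x|x] [y|y] Ax Ay xy //=; [apply: cA1|apply: cA2] => // exy;
  apply: xy; rewrite exy.
Qed.

Lemma clique_join_set A1 A2 :
  clique (join_set A1 A2) <-> clique A1 /\ clique A2.
Proof.
split=> [[/complete_join_set[cA1 cA2] Amax] | [[cA1 A1max] [cA2 A2max]]].
  split; split=> // Q cQ AQ.
    (* Enlarging one side while keeping the other gives a complete set of the join, so maximality
       there forces [Q = A1]. *)
    have E : join_set Q A2 = join_set A1 A2.
      by apply: Amax; [exact/complete_join_set | case=> //= x; exact: AQ].
    by apply/funext => x; exact: (congr1 (@^~ (inl x)) E).
  have E : join_set A1 Q = join_set A1 A2.
    by apply: Amax; [exact/complete_join_set | case=> //= x; exact: AQ].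
  by apply/funext => x; exact: (congr1 (@^~ (inr x)) E).
split; first exact/complete_join_set.
(* Each trace of [Q] is complete and contains the clique on its side, hence equals it. *)
move=> Q; rewrite (join_setE Q) => /complete_join_set[cQ1 cQ2] AQ.
have -> := A1max _ cQ1 (fun x => AQ (inl x)).
by have -> := A2max _ cQ2 (fun x => AQ (inr x)).
Qed.

End CliquesOfJoin.

Theorem theorem2p3 (G1 G2 : graph) :
  complete_graph (clique_graph (graph_join G1 G2)) <->
  complete_graph (clique_graph G1) \/ complete_graph (clique_graph G2).
Proof.
split=> [/complete_clique_graphP meet | KG].
  apply: contrapT => /not_orP[].
  move=> /not_complete_clique_graph[P1 [Q1 [cP1 cQ1 PQ1]]].
  move=> /not_complete_clique_graph[P2 [Q2 [cP2 cQ2 PQ2]]].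
  (* Pairing the disjoint cliques across the two sides yields two cliques of the join that meet on
     neither side. *)
  have cP : clique (join_set P1 P2) by exact/clique_join_set.
  have cQ : clique (join_set Q1 Q2) by exact/clique_join_set.
  by have /join_setI_nonempty[] := meet _ _ cP cQ.
apply/complete_clique_graphP => P Q; rewrite (join_setE P) (join_setE Q).
move=> /clique_join_set[cP1 cP2] /clique_join_set[cQ1 cQ2].
apply/join_setI_nonempty.
(* Traces of cliques are cliques, so they already meet on the side whose clique graph is
   complete. *)
by case: KG => /complete_clique_graphP meet; [left | right]; exact: meet.
Qed.
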